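(* Let $f:\mathbb{R}^d\to[0,\infty)$ be Lipschitz continuous with Lipschitz constant $L_f>0$, and let the random process $\{x^{i,k}\}_{i=1}^N$, $k\ge 0$, be generated by the ESCBO algorithm. Assume that the parameters $\lambda,\delta$ and the step sizes $\{\alpha_k\}_{k\ge0}$ satisfy $$(1-\lambda)^2+\delta^2<\frac12\quad\text{and}\quad \lim_{k\to\infty}\alpha_k=0.$$ Then the ESCBO algorithm reaches $L^2$ global consensus in an exponential rate, i.e. $\lim_{k\to\infty}\max_{i,j\in[N]}\mathbb{E}\left[\|x^{i,k}-x^{j,k}\|^2\right]=0$, and there exist constants $C>0$ and $\tau>0$ such that $\mathbb{E}\left[\|x^{i,k}-x^{j,k}\|^2\right]\le C\mathrm{e}^{-\tau k}$ for all $k\ge 0$ and all $i,j\in[N]$.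
   Context: $[N]=\{1,\dots,N\}$; $\|\cdot\|$ is the Euclidean norm; $\odot$ is the componentwise (Hadamard) product; $e_l$ is the $l$-th column of the identity matrix. Forward-difference gradient estimator with interval $\sigma>0$: $g(x)\in\mathbb{R}^d$ with $[g(x)]_l=\frac{f(x+\sigma e_l)-f(x)}{\sigma}$, $l\in[d]$. ESCBO algorithm: given $N$, initial points $x^{i,0}\in\mathbb{R}^d$ ($i\in[N]$), parameters $\beta>0$, $\lambda>0$, $\delta\ge0$, $\sigma>0$ and a nonnegative sequence $\{\alpha_k\}_{k\ge0}$, for $k=0,1,2,\dots$ set $$\bar x^{\star,k}=\frac{\sum_{i=1}^N x^{i,k}\mathrm{e}^{-\beta f(x^{i,k})}}{\sum_{i=1}^N \mathrm{e}^{-\beta f(x^{i,k})}},$$ draw a random vector $\eta^k=(\eta^k_1,\dots,\eta^k_d)^\top$ with i.i.d. components $\eta^k_l\sim\mathcal{N}(0,\delta^2)$ (the same $\eta^k$ is used for all particles; the vectors $\eta^0,\eta^1,\dots$ are mutually independent), and for every $i\in[N]$ set $$y^{i,k+1}=x^{i,k}-\lambda(x^{i,k}-\bar x^{\star,k})-(x^{i,k}-\bar x^{\star,k})\odot\eta^k,\qquad x^{i,k+1}=y^{i,k+1}-\alpha_k\,g(x^{i,k}).$$ *)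

(* Defs.v *)
From HB Require Import structures.
From mathcomp Require Import all_boot all_order all_algebra.
From mathcomp Require Import all_classical all_reals all_analysis.

Set Implicit Arguments.
Unset Strict Implicit.
Unset Printing Implicit Defensive.

Import Order.TTheory GRing.Theory Num.Theory.
Import numFieldNormedType.Exports.

Local Open Scope classical_set_scope.
Local Open Scope ring_scope.

(* Euclidean norm; the library norm on matrices is the sup norm. *)
Definition enorm (R : realType) (d : nat) (x : 'rV[R]_d) : R :=
  Num.sqrt (\sum_(l < d) x ord0 l ^+ 2).

Definition elipschitz (R : realType) (d : nat) (L : R) (f : 'rV[R]_d -> R) :
    Prop :=
  forall x y : 'rV[R]_d, `|f x - f y| <= L * enorm (x - y).

Definition fwd_grad (R : realType) (d : nat) (f : 'rV[R]_d -> R) (sigma : R)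
    (x : 'rV[R]_d) : 'rV[R]_d :=
  \row_(l < d) ((f (x + sigma *: delta_mx ord0 l) - f x) / sigma).

Definition consensus_point (R : realType) (d N : nat) (f : 'rV[R]_d -> R)
    (beta : R) (x : 'I_N -> 'rV[R]_d) : 'rV[R]_d :=
  (\sum_(i < N) expR (- beta * f (x i)))^-1 *:
  \sum_(i < N) expR (- beta * f (x i)) *: x i.

Definition hadamard (R : realType) (d : nat) (x y : 'rV[R]_d) : 'rV[R]_d :=
  map2_mx *%R x y.

(* The law N(m, s^2). The library's normal_prob m 0 is the uniform law on
   [0, 1], so the degenerate case has to be treated apart. *)
Definition gaussian (R : realType) (m s : R) : set R -> \bar R :=
  if s == 0 then \d_m else normal_prob m s.

Definition mutually_independent (disp disp' : measure_display)
    (T : measurableType disp) (T' : measurableType disp') (R : realType)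
    (P : probability T R) (I : eqType) (X : I -> T -> T') : Prop :=
  forall (J : seq I) (B : I -> set T'), uniq J ->
    (forall i, measurable (B i)) ->
    P (\bigcap_(i in [set` J]) (X i @^-1` B i)) =
    (\prod_(i <- J) P (X i @^-1` B i))%E.

(* Random vectors are d-tuple valued because tuples, unlike 'rV[R]_d, carry
   the product sigma-algebra in the library. *)
Definition escbo_noise (disp : measure_display) (T : measurableType disp)
    (R : realType) (P : probability T R) (d : nat) (delta : R)
    (eta : nat -> {RV P >-> d.-tuple R}) : Prop :=
  [/\ forall k (l : 'I_d) (B : set R), measurable B ->
        pushforward P (fun w => tnth (eta k w) l) B = gaussian 0 delta B,
      forall k, mutually_independent P (fun (l : 'I_d) w => tnth (eta k w) l)
    & mutually_independent P (fun k w => eta k w)].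

Definition escbo_step (R : realType) (d N : nat) (f : 'rV[R]_d -> R)
    (beta lambda sigma a : R) (z : d.-tuple R) (x : 'I_N -> 'rV[R]_d)
    (i : 'I_N) : 'rV[R]_d :=
  let dev := x i - consensus_point f beta x in
  let y := x i - lambda *: dev - hadamard dev (\row_(l < d) tnth z l) in
  y - a *: fwd_grad f sigma (x i).

Definition escbo_process (disp : measure_display) (T : measurableType disp)
    (R : realType) (P : probability T R) (d N : nat) (f : 'rV[R]_d -> R)
    (beta lambda delta sigma : R) (alpha : nat -> R) (x0 : 'I_N -> 'rV[R]_d)
    (eta : nat -> {RV P >-> d.-tuple R}) (x : 'I_N -> nat -> T -> 'rV[R]_d) :
    Prop :=
  [/\ escbo_noise delta eta,
      forall i w, x i 0%N w = x0 i
    & forall i k w, x i k.+1 w =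
        escbo_step f beta lambda sigma (alpha k) (eta k w)
          (fun j => x j k w) i].

(* Main.v *)
(* Consensus point and noise are common to all particles, so coordinate l of
   D^k = x^{i,k} - x^{j,k} satisfies
     D_l^{k+1} = (1 - lambda - eta_l^k) D_l^k - alpha_k (g_l(x^i) - g_l(x^j)),
   where |g_l(x^i) - g_l(x^j)| <= (2 L_f / sigma) ||D^k|| by Lipschitz
   continuity. Using (u - v)^2 <= 2 u^2 + 2 v^2, the independence of eta^k from
   the past and E[(1 - lambda - eta_l^k)^2] <= (1 - lambda)^2 + delta^2 =: rho,
   this gives E||D^{k+1}||^2 <= (2 rho + O(alpha_k^2)) E||D^k||^2 with
   2 rho < 1. *)
Require Import Defs.
From HB Require Import structures.
From mathcomp Require Import all_boot all_order all_algebra.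
From mathcomp Require Import ring lra.
From mathcomp Require Import all_classical all_reals all_analysis.
From mathcomp Require Import measurable_realfun.

Set Implicit Arguments.
Unset Strict Implicit.
Unset Printing Implicit Defensive.

Import Order.TTheory GRing.Theory Num.Theory.
Import numFieldNormedType.Exports.

Local Open Scope classical_set_scope.
Local Open Scope ring_scope.

(** * Integration tools and second moments of Gaussian laws *)

Section integration.
Import HBNNSimple.
Context {R : realType}.
Local Open Scope ereal_scope.

(* This avoids discussing measurability of the iterates: ['rV[R]_d] carries no
   sigma-algebra in the library. *)
Lemma ge0_le_integral_nonmeasurable d (X : measurableType d)
    (mu : {measure set X -> \bar R}) (f g : X -> \bar R) :
  (forall x, 0 <= f x) -> (forall x, f x <= g x) ->
  \int[mu]_x f x <= \int[mu]_x g x.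
Proof.
move=> f0 fg; have g0 x : 0 <= g x by exact: le_trans (fg x).
rewrite !ge0_integralTE//; apply: ereal_sup_le => _ [h hf <-].
by exists h => // x; exact: le_trans (fg x).
Qed.

(** The hypothesis on sets is the case of indicators; linearity extends it to simple functions and
    monotone convergence to all [psi]. The weight [g] serves as a density for normal laws, as the
    constant 1 for laws of random variables, and as a random variable on a cylinder [D] in the
    independence argument. *)
Lemma ge0_integral_change d d' (X : measurableType d) (Y : measurableType d')
    (mu : {measure set X -> \bar R}) (nu : {measure set Y -> \bar R})
    (D : set X) (g : X -> R) (phi : X -> Y) (c : \bar R) :
  measurable D -> measurable_fun [set: X] g -> (forall x, 0 <= g x)%R ->
  measurable_fun [set: X] phi -> c \is a fin_num ->
  (forall B, measurable B ->
    \int[mu]_(x in D `&` phi @^-1` B) (g x)%:E = c * nu B) ->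
  forall psi : Y -> R, measurable_fun [set: Y] psi ->
  (forall y, 0 <= psi y)%R ->
  \int[mu]_(x in D) (g x * psi (phi x))%:E = c * \int[nu]_y (psi y)%:E.
Proof.
move=> mD mg g0 mphi fc gnu psi mpsi psi0.
have mEpsi : measurable_fun [set: Y] (fun y => (psi y)%:E).
  exact/measurable_EFinP.
have Epsi0 y : setT y -> 0 <= (psi y)%:E by move=> _; rewrite lee_fin.
pose f_ := nnsfun_approx measurableT mEpsi.
have f_cvg y : (f_ n y)%:E @[n --> \oo] --> (psi y)%:E.
  exact: (@cvg_nnsfun_approx _ _ _ _ measurableT _ mEpsi Epsi0 y).
have f_nd y : {homo (fun n => f_ n y) : m n / (m <= n)%N >-> (m <= n)%R}.
  by move=> m n mn; exact/lefP/nd_nnsfun_approx.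
have mfphi n : measurable_fun [set: X] (fun x => f_ n (phi x)).
  exact: measurableT_comp.
have lhs : \int[mu]_(x in D) (g x * f_ n (phi x))%:E @[n --> \oo] -->
    \int[mu]_(x in D) (g x * psi (phi x))%:E.
  have -> : \int[mu]_(x in D) (g x * psi (phi x))%:E =
      \int[mu]_(x in D) limn (fun n => (g x * f_ n (phi x))%:E).
    apply: eq_integral => x _; apply/esym/cvg_lim => //.
    by rewrite EFinM; under eq_fun do rewrite EFinM; exact: cvgeZl.
  apply: (@cvg_monotone_convergence _ _ _ mu D mD
    (fun n x => (g x * f_ n (phi x))%:E)).
  - move=> n; apply/measurable_EFinP/measurable_funTS.
    exact: measurable_funM.
  - by move=> n x _; rewrite lee_fin mulr_ge0.
  - by move=> x _ m n mn; rewrite lee_fin ler_wpM2l// f_nd.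
have rhs : c * \int[nu]_y (f_ n y)%:E @[n --> \oo] -->
    c * \int[nu]_y (psi y)%:E.
  apply: cvgeZl => //.
  have -> : \int[nu]_y (psi y)%:E =
      \int[nu]_y limn (fun n => (f_ n y)%:E).
    by apply: eq_integral => y _; apply/esym/cvg_lim => //; exact: f_cvg.
  apply: (@cvg_monotone_convergence _ _ _ nu setT measurableT
    (fun n y => (f_ n y)%:E)) => //.
  - by move=> n; exact/measurable_EFinP.
  - by move=> n y _; rewrite lee_fin.
  - by move=> y _ m n mn; rewrite lee_fin f_nd.
(* Both sides are limits along the same approximation, so the identity is needed only for each
   simple [f_ n], level set by level set. *)
rewrite -(cvg_lim _ lhs)// -(cvg_lim _ rhs)//; congr (limn _).
apply/funext => n.
have mpre r : measurable (f_ n @^-1` [set r]).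
  rewrite -[X in measurable X]setTI; exact: measurable_funP.
have mprephi r : measurable (phi @^-1` (f_ n @^-1` [set r])).
  by rewrite -[X in measurable X]setTI; exact: mphi.
transitivity (\sum_(r \in range (f_ n)) \int[mu]_(x in D)
    (r%:E * (g x * \1_(phi @^-1` (f_ n @^-1` [set r])) x)%:E)).
  rewrite -ge0_integral_fsum//.
  - apply: eq_integral => x _; rewrite {1}(fimfunE (f_ n)).
    rewrite EFinM -fsumEFin// ge0_mule_fsumr; last first.
      by move=> r; exact: nnfun_muleindic_ge0.
    by apply: eq_fsbigr => r _; rewrite !EFinM muleCA.
  - move=> r; apply: measurable_funeM; apply/measurable_EFinP/measurable_funTS.
    by apply: measurable_funM => //; exact: measurable_indic.
  (* A negative [r] has an empty level set, since [f_ n] is nonnegative; its term is zero. *)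
  - move=> r x _; have [r0|r0] := ltP r 0%R.
      by rewrite preimage_nnfun0// preimage_set0 indic0 mulr0 mule0.
    by rewrite mule_ge0// lee_fin mulr_ge0.
under [in RHS]eq_integral do rewrite fimfunE -fsumEFin//.
rewrite ge0_integral_fsum//; last 2 first.
- by move=> r; exact/measurable_EFinP/measurable_funM.
- by move=> r y _; rewrite nnfun_muleindic_ge0.
rewrite ge0_mule_fsumr; last first.
  by move=> r; apply: integral_ge0 => y _; exact: nnfun_muleindic_ge0.
apply: eq_fsbigr => r _; have [r0|r0] := ltP r 0%R.
  rewrite preimage_nnfun0//.
  rewrite integral0_eq; last first.
    by move=> x _; rewrite preimage_set0 indic0 mulr0 mule0.
  rewrite integral0_eq ?mule0// => y _.
  by rewrite indic0 mulr0.
rewrite ge0_integralZl_EFin//; last 2 first.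
- by move=> x _; rewrite lee_fin mulr_ge0.
- apply/measurable_EFinP/measurable_funTS.
  by apply: measurable_funM => //; exact: measurable_indic.
rewrite integralZl_indic_nnsfun// integral_indic// setIT muleCA -gnu//.
congr (_ * _); rewrite integral_mkcondr; apply: eq_integral => x _.
by rewrite /patch indicE; case: ifPn => _; rewrite ?mulr1 ?mulr0.
Qed.

Lemma integral_normal_prob (m s : R) (psi : R -> R) :
  measurable_fun [set: R] psi -> (forall x, 0 <= psi x)%R ->
  \int[normal_prob m s]_x (psi x)%:E =
  \int[lebesgue_measure]_x (normal_pdf m s x * psi x)%:E.
Proof.
move=> mpsi psi0; rewrite -[LHS]mul1e; apply/esym.
apply: (@ge0_integral_change _ _ _ _ lebesgue_measure (normal_prob m s)
  setT (normal_pdf m s) id) => //.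
- exact: measurable_normal_pdf.
- exact: normal_pdf_ge0.
- by move=> B mB; rewrite setTI mul1e.
Qed.

(* [1 + y <= expR y], with the factor of [x ^+ 2] chosen so that the
   exponential turns the N(0, s^2) density into a multiple of the N(0, (r s)^2)
   density; integrating and letting [r] tend to 1 bounds the second moment by
   [s ^+ 2]. *)
Lemma normal_pdf_expand (s r x : R) : (0 < s)%R -> (1 < r)%R ->
  (normal_pdf 0 s x * (1 + (1 - r ^- 2) / (2 * s ^+ 2) * x ^+ 2) <=
   r * normal_pdf 0 (r * s) x)%R.
Proof.
move=> s0 r1; have r0 : (0 < r)%R by exact: lt_trans r1.
rewrite !normal_pdfE ?mulf_neq0 ?gt_eqF// /normal_peak /normal_fun subr0.
set u := ((1 - r ^- 2) / _)%R.
have -> : (Num.sqrt ((r * s) ^+ 2 * pi *+ 2) =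
    r * Num.sqrt (s ^+ 2 * pi *+ 2))%R.
  rewrite exprMn -mulrA -mulrnAr sqrtrM ?sqr_ge0//.
  by rewrite sqrtr_sqr ger0_norm ?ltW.
set k := Num.sqrt _.
have rk y : (r * ((r * k)^-1 * y) = k^-1 * y)%R.
  by rewrite invfM !mulrA divff ?mul1r ?gt_eqF.
rewrite {}rk -mulrA ler_wpM2l ?invr_ge0 ?sqrtr_ge0//.
have -> : (- x ^+ 2 / ((r * s) ^+ 2 *+ 2) =
    - x ^+ 2 / (s ^+ 2 *+ 2) + u * x ^+ 2)%R.
  by rewrite /u; field; rewrite !gt_eqF.
by rewrite expRD ler_wpM2l ?expR_ge0// expR_ge1Dx.
Qed.

Lemma normal_second_moment_le (s : R) : (0 < s)%R ->
  \int[lebesgue_measure]_x (normal_pdf 0 s x * x ^+ 2)%:E <= (s ^+ 2)%:E.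
Proof.
move=> s0; apply/lee_addgt0Pr => e e0.
(* Integrating [normal_pdf_expand] will give [1 + u * M <= r] for the second moment [M], that is [M
   <= 2 * s ^+ 2 * r ^+ 2 / (r + 1) <= s ^+ 2 * r ^+ 2]; this [r] makes the last quantity
   [s ^+ 2 + e]. *)
pose r := Num.sqrt (1 + e / s ^+ 2).
have es0 : (0 < e / s ^+ 2)%R by rewrite divr_gt0// exprn_gt0.
have r2 : (r ^+ 2 = 1 + e / s ^+ 2)%R by rewrite sqr_sqrtr// ltW// addr_gt0.
have r1 : (1 < r)%R by rewrite -sqrtr1 ltr_sqrt ?ltrDl// addr_gt0.
have r0 : (0 < r)%R by exact: lt_trans r1.
pose u := ((1 - r ^- 2) / (2 * s ^+ 2))%R.
have u0 : (0 < u)%R.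
  rewrite divr_gt0 ?mulr_gt0 ?exprn_gt0// subr_gt0 invf_lt1 ?exprn_gt0//.
  by rewrite exprn_egt1.
set M := \int[_]_x _.
have px0 x : 0 <= (normal_pdf 0 s x * x ^+ 2)%:E.
  by rewrite lee_fin mulr_ge0 ?sqr_ge0 ?normal_pdf_ge0.
have M0 : 0 <= M.
  by apply: integral_ge0 => x _; exact: px0.
have mpx : measurable_fun [set: R] (fun x => normal_pdf 0 s x * x ^+ 2)%R.
  by apply: measurable_funM;
    [exact: measurable_normal_pdf|exact: measurable_funX].
have : 1 + u%:E * M <= r%:E.
  rewrite -(integral_normal_pdf 0 s) -ge0_integralZl_EFin//; last 2 first.
  - exact/measurable_EFinP.
  - exact: ltW.
  rewrite -ge0_integralD//=; last 4 first.
  - by move=> x _; rewrite lee_fin normal_pdf_ge0.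
  - by apply/measurable_EFinP; exact: measurable_normal_pdf.
  - by move=> x _; rewrite mule_ge0 ?px0 ?lee_fin ?(ltW u0).
  - by apply: measurable_funeM; exact/measurable_EFinP.
  rewrite -[leRHS]mule1 -(integral_normal_pdf 0 (r * s)).
  rewrite -ge0_integralZl_EFin//; last 3 first.
  - by move=> x _; rewrite lee_fin normal_pdf_ge0.
  - by apply/measurable_EFinP; exact: measurable_normal_pdf.
  - exact: ltW.
  apply: ge0_le_integral_nonmeasurable => x.
    by rewrite adde_ge0 ?mule_ge0 ?px0 ?lee_fin ?normal_pdf_ge0 ?(ltW u0).
  rewrite lee_fin; apply: le_trans (normal_pdf_expand x s0 r1).
  by rewrite -/u mulrDr mulr1 mulrCA.
(* An infinite [M] would contradict the bound, because [u] is positive. *)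
case: M M0 => [M| |]//= M0; last by rewrite gt0_muley ?lte_fin.
rewrite -EFinM -EFinD !lee_fin => uM.
have -> : (s ^+ 2 + e = s ^+ 2 * r ^+ 2)%R.
  by rewrite r2 mulrDr mulr1 mulrC divfK// expf_neq0// gt_eqF.
have uE : (u * (2 * s ^+ 2 * r ^+ 2) = r ^+ 2 - 1)%R.
  by rewrite /u; field; rewrite !gt_eqF.
have : (u * M <= r - 1)%R by lra.
rewrite -(ler_pM2r (_ : 0 < r + 1)%R) ?addr_gt0//.
have -> : ((r - 1) * (r + 1) = r ^+ 2 - 1)%R by ring.
rewrite -uE -(mulrA u M) (ler_pM2l u0) => Mr.
rewrite lee_fin in M0.
have : (2 * M <= M * (r + 1))%R by rewrite mulrC ler_wpM2l//; lra.
by rewrite -mulrA in Mr; lra.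
Qed.

(** Only nonnegative integrands occur, which avoids proving integrability of the linear term. *)
Lemma normal_sqr_dev_le (c s : R) : (0 < s)%R ->
  \int[normal_prob 0 s]_x ((c - x) ^+ 2)%:E <= (c ^+ 2 + s ^+ 2)%:E.
Proof.
move=> s0; pose p := normal_pdf (0 : R) s.
have mp : measurable_fun [set: R] p by exact: measurable_normal_pdf.
have p0 x : (0 <= p x)%R by exact: normal_pdf_ge0.
rewrite integral_normal_prob; last 2 first.
- by apply: measurable_funX; exact: measurable_funB.
- by move=> x; exact: sqr_ge0.
have mB : measurable_fun [set: R] (fun x => p x * (c - x) ^+ 2)%R.
  apply: measurable_funM => //.
  by apply: measurable_funX; exact: measurable_funB.
have mD : measurable_fun [set: R] (fun x => p x * (c + x) ^+ 2)%R.
  apply: measurable_funM => //.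
  by apply: measurable_funX; exact: measurable_funD.
set A := \int[_]_x _.
(* By symmetry, the cross term vanishes from twice the integral. *)
have AE : A = \int[lebesgue_measure]_x (p x * (c + x) ^+ 2)%:E.
  (* The reflection of the line preserves Lebesgue measure and the centred density. *)
  transitivity (\int[pushforward lebesgue_measure
      (-%R : _ -> measurableTypeR R)]_x (p x * (c - x) ^+ 2)%:E).
    by apply: eq_measure_integral => B mB' _; exact/esym/lebesgue_measureN.
  rewrite ge0_integral_pushforward//; last 2 first.
  - exact/measurable_EFinP.
  - by move=> x _; rewrite lee_fin mulr_ge0 ?sqr_ge0.
  rewrite preimage_setT; apply: eq_integral => x _ /=.
  rewrite opprK /p !normal_pdfE ?gt_eqF// /normal_fun.
  by rewrite !subr0 sqrrN.
have : A + A <= (2 * (c ^+ 2 + s ^+ 2))%:E.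
  rewrite [X in _ + X]AE -ge0_integralD//; last 4 first.
  - by move=> x _; rewrite lee_fin mulr_ge0 ?sqr_ge0.
  - exact/measurable_EFinP.
  - by move=> x _; rewrite lee_fin mulr_ge0 ?sqr_ge0.
  - exact/measurable_EFinP.
  have expand x : (p x * (c - x) ^+ 2)%:E + (p x * (c + x) ^+ 2)%:E =
      (2 * c ^+ 2)%:E * (p x)%:E + 2%:E * (p x * x ^+ 2)%:E.
    by rewrite -!EFinM -!EFinD; congr EFin; ring.
  under eq_integral do rewrite expand.
  have mx2 : measurable_fun [set: R] (fun x => p x * x ^+ 2)%R.
    by apply: measurable_funM => //; exact: measurable_funX.
  have c20 : (0 <= 2 * c ^+ 2)%R by rewrite mulr_ge0// sqr_ge0.
  have Ep0 x : 0 <= (p x)%:E by rewrite lee_fin.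
  have px20 x : 0 <= (p x * x ^+ 2)%:E by rewrite lee_fin mulr_ge0 ?sqr_ge0.
  rewrite ge0_integralD//; last 4 first.
  - by move=> x _; exact: mule_ge0.
  - by apply: measurable_funeM; exact/measurable_EFinP.
  - by move=> x _; exact: mule_ge0.
  - by apply: measurable_funeM; exact/measurable_EFinP.
  rewrite !ge0_integralZl_EFin//; last 2 first.
  - exact/measurable_EFinP.
  - exact/measurable_EFinP.
  rewrite integral_normal_pdf mule1 mulrDr [leRHS]EFinD; apply: leeD2l.
  rewrite [leRHS]EFinM.
  by rewrite lee_pmul2l ?lte_fin// normal_second_moment_le.
have A0 : 0 <= A.
  by apply: integral_ge0 => x _; rewrite lee_fin mulr_ge0 ?sqr_ge0.
by case: A A0 {AE} => [A| |]//= A0; rewrite -EFinD !lee_fin => ?; lra.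
Qed.

Lemma gaussian_sqr_dev_le d (X : measurableType d)
    (P : probability X R) (Z : X -> R) (c s : R) :
  measurable_fun [set: X] Z -> (0 <= s)%R ->
  (forall B, measurable B -> pushforward P Z B = gaussian 0 s B) ->
  \int[P]_w ((c - Z w) ^+ 2)%:E <= (c ^+ 2 + s ^+ 2)%:E.
Proof.
move=> mZ s0 Zs.
have mc : measurable_fun [set: R] (fun x => (c - x) ^+ 2)%R.
  by apply: measurable_funX; exact: measurable_funB.
have change (nu : {measure set (measurableTypeR R) -> \bar R}) :
    (forall B, measurable B -> P (Z @^-1` B) = nu B) ->
    \int[P]_w ((c - Z w) ^+ 2)%:E = \int[nu]_x ((c - x) ^+ 2)%:E.
  move=> Znu; rewrite -[RHS]mul1e.
  rewrite -(@ge0_integral_change _ _ _ _ P nu setT (cst 1%R) Z)//.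
  - by apply: eq_integral => w _; rewrite /= mul1r.
  - move=> B mB; rewrite setTI mul1e -Znu//= integral_cst ?mul1e//.
    by rewrite -[X in measurable X]setTI; exact: mZ.
  - by move=> x; exact: sqr_ge0.
(* For [s = 0] the law is the Dirac mass at 0 and the integral is exactly [c ^+ 2]. *)
move: Zs; rewrite /gaussian; case: eqVneq => [-> Zs|sn0 Zs].
  rewrite (change (\d_(0%R : measurableTypeR R)))// integral_dirac//;
    last exact/measurable_EFinP.
  by rewrite diracT mul1e subr0 expr0n/= addr0.
rewrite (change (normal_prob 0 s))//.
by apply: normal_sqr_dev_le; rewrite lt_neqAle eq_sym sn0.
Qed.

End integration.

(** * Independence of a random variable from future noise *)

Section future_independence.
Context {R : realType} {dT dS : measure_display}.
Context {T : measurableType dT} {S : measurableType dS}.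
Variables (P : probability T R) (eta : nat -> {RV P >-> S}).
Local Open Scope ereal_scope.

Definition cylinder (J : seq nat) (B : nat -> set S) : set T :=
  \bigcap_(i in [set` J]) (eta i @^-1` B i).

(* For nonnegative [Y] with mean [m], this is independence of [Y] from
   [(eta j)_(j >= k)], tested on finite-dimensional rectangles. *)
Definition indep_from (k : nat) (Y : T -> R) (m : R) : Prop :=
  [/\ measurable_fun [set: T] Y, forall w, (0 <= Y w)%R
    & forall J B, uniq J -> {in J, forall j, (k <= j)%N} ->
        (forall i, measurable (B i)) ->
        \int[P]_(w in cylinder J B) (Y w)%:E =
        m%:E * \prod_(i <- J) P (eta i @^-1` B i)].

Let measurable_preimage i (C : set S) :
  measurable C -> measurable (eta i @^-1` C).
Proof.
by move=> mC; rewrite -[X in measurable X]setTI; exact: measurable_funP.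
Qed.

Lemma measurable_cylinder (J : seq nat) (B : nat -> set S) :
  (forall i, measurable (B i)) -> measurable (cylinder J B).
Proof.
move=> mB; apply: fin_bigcap_measurable => // i _.
exact: measurable_preimage.
Qed.

(** Tested on the empty list of indices, whose cylinder is the whole space. *)
Lemma indep_from_mean k Y m : indep_from k Y m -> \int[P]_w (Y w)%:E = m%:E.
Proof.
move=> [_ _ /(_ [::] (fun=> setT))]; rewrite big_nil mule1 => <-//.
by rewrite /cylinder set_nil bigcap_set0.
Qed.

Lemma indep_from_mean_ge0 k Y m : indep_from k Y m -> (0 <= m)%R.
Proof.
move=> YP; rewrite -lee_fin -(indep_from_mean YP).
by apply: integral_ge0 => w _; case: YP => _ Y0 _; rewrite lee_fin.
Qed.

(** For a constant, the required factorization is the mutual independence of the noise vectors. *)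
Lemma indep_from_cst k (r : R) : mutually_independent P (fun k w => eta k w) ->
  (0 <= r)%R -> indep_from k (fun=> r) r.
Proof.
move=> ieta r0; split => // J B uJ _ mB.
rewrite integral_cst; last exact: measurable_cylinder.
by congr (_ * _); exact: ieta.
Qed.

Lemma indep_fromD k Y1 m1 Y2 m2 : indep_from k Y1 m1 -> indep_from k Y2 m2 ->
  indep_from k (fun w => Y1 w + Y2 w)%R (m1 + m2)%R.
Proof.
move=> [mY1 Y10 iY1] [mY2 Y20 iY2]; split.
- exact: measurable_funD.
- by move=> w; rewrite addr_ge0.
- move=> J B uJ Jk mB; under eq_integral do rewrite EFinD.
  rewrite ge0_integralD//; last 5 first.
  - exact: measurable_cylinder.
  - by move=> w _; rewrite lee_fin.
  - exact/measurable_EFinP/measurable_funTS.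
  - by move=> w _; rewrite lee_fin.
  - exact/measurable_EFinP/measurable_funTS.
  rewrite iY1// iY2// EFinD muleDl//.
  by apply: prode_fin_num => i _; exact/fin_num_measure/measurable_preimage.
Qed.

Lemma indep_fromZ k (r : R) Y m : (0 <= r)%R -> indep_from k Y m ->
  indep_from k (fun w => r * Y w)%R (r * m)%R.
Proof.
move=> r0 [mY Y0 iY]; split.
- exact: measurable_funM.
- by move=> w; rewrite mulr_ge0.
- move=> J B uJ Jk mB; under eq_integral do rewrite EFinM.
  rewrite ge0_integralZl_EFin//; last 3 first.
  - exact: measurable_cylinder.
  - by move=> w _; rewrite lee_fin.
  - exact/measurable_EFinP/measurable_funTS.
  by rewrite iY// EFinM muleA.
Qed.

Lemma indep_from_sum k (I : Type) (s : seq I) (Y : I -> T -> R) (m : I -> R) :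
  mutually_independent P (fun k w => eta k w) ->
  (forall i, indep_from k (Y i) (m i)) ->
  indep_from k (fun w => \sum_(i <- s) Y i w)%R (\sum_(i <- s) m i)%R.
Proof.
move=> ieta iY; elim: s => [|i s IHs].
  by rewrite big_nil; under eq_fun do rewrite big_nil; exact: indep_from_cst.
by rewrite big_cons; under eq_fun do rewrite big_cons; exact: indep_fromD.
Qed.

Lemma indep_fromS k Y m : indep_from k Y m -> indep_from k.+1 Y m.
Proof.
move=> [mY Y0 iY]; split => // J B uJ Jk mB.
by apply: iY => // j /Jk /ltnW.
Qed.

(** Multiplication by a function of the fresh noise [eta k]. Adding the index [k] to a rectangle
    shows that the measure with density [Y] on the cylinder is pushed forward by [eta k] to a
    multiple of the law of [eta k], so the integral of [psi] factors out. Independence then survives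
    only from [k.+1] on. *)
Lemma indep_fromM k Y m (psi : S -> R) (p : R) : indep_from k Y m ->
  measurable_fun [set: S] psi -> (forall z, 0 <= psi z)%R ->
  \int[P]_w (psi (eta k w))%:E = p%:E ->
  indep_from k.+1 (fun w => Y w * psi (eta k w))%R (m * p)%R.
Proof.
move=> [mY Y0 iY] mpsi psi0 psip.
have mpsieta : measurable_fun [set: T] (fun w => psi (eta k w)).
  exact: measurableT_comp.
split.
- exact: measurable_funM.
- by move=> w; rewrite mulr_ge0.
move=> J B uJ Jk mB.
have kJ : k \notin J by apply/negP => /Jk; rewrite ltnn.
set c := \prod_(i <- J) P (eta i @^-1` B i).
have fc : c \is a fin_num.
  by apply: prode_fin_num => i _; exact/fin_num_measure/measurable_preimage.
rewrite (@ge0_integral_change _ _ _ _ _ P (pushforward P (eta k))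
  (cylinder J B) Y (eta k) (m%:E * c)) //; last 3 first.
- exact: measurable_cylinder.
- by rewrite fin_numM.
(* [B'] inserts [C] at index [k]. As [J] lies above [k], the list [k :: J] is duplicate-free and its
   cylinder is the intersection in question. *)
- move=> C mC; pose B' i := if i == k then C else B i.
  have B'J i : i \in J -> B' i = B i.
    by rewrite /B'; case: eqP => // -> kJ'; rewrite kJ' in kJ.
  have <- : cylinder (k :: J) B' = cylinder J B `&` eta k @^-1` C.
    rewrite /cylinder; apply/seteqP; split => [w Bw|w [Bw Cw] i]/=.
      split; last by have := Bw k; rewrite /= mem_head /B' eqxx; apply.
      by move=> i iJ; rewrite -(B'J _ iJ); apply: Bw; rewrite /= inE iJ orbT.
    rewrite inE => /predU1P[->|iJ]; first by rewrite /B' eqxx.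
    by rewrite (B'J _ iJ); exact: Bw.
  rewrite iY; first last.
  - by move=> i; rewrite /B'; case: ifP.
  - by move=> i; rewrite inE => /predU1P[->//|/Jk/ltnW].
  - by rewrite /= kJ.
  rewrite big_cons {1}/B' eqxx -muleA; congr (_ * _); rewrite muleC.
  by congr (_ * _); apply: eq_big_seq => i /B'J ->.
rewrite ge0_integral_pushforward//; last 2 first.
- exact/measurable_EFinP.
- by move=> x _; rewrite lee_fin.
by rewrite preimage_setT [X in _ * X]psip EFinM muleAC.
Qed.

End future_independence.

(** Induction on the threshold past which [r k <= q]: shifting the sequence lowers it by one and
    costs only the factor [r 0], absorbed in [K]. *)
Lemma prod_le_geometric (R : realType) (r : nat -> R) (q : R) : 0 < q ->
  (forall k, 0 <= r k) -> (\forall k \near \oo, r k <= q) ->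
  exists2 K : R, 0 < K & forall k, \prod_(i < k) r i <= K * q ^+ k.
Proof.
move=> q0 r0 [m _]; elim: m r r0 => [|m IHm] r r0 rq.
  exists 1 => // k; rewrite mul1r.
  elim: k => [|k IHk]; first by rewrite big_ord0.
  rewrite big_ord_recr exprSr /= ler_pM ?r0 ?rq//.
  by apply: prodr_ge0 => i _.
have [k|k mk|K K0 rK] := IHm (fun k => r k.+1); [exact: r0|exact: rq|].
(* The 1 covers the empty product and keeps the constant positive when [r 0 = 0]; dividing by [q]
   offsets the exponent lost by peeling off the first factor. *)
exists (1 + r 0%N * K / q).
  by rewrite ltr_wpDr// divr_ge0 ?mulr_ge0// ltW.
case=> [|k].
  by rewrite big_ord0 mulr1 lerDl divr_ge0 ?mulr_ge0// ltW.
rewrite big_ord_recl mulrDl mul1r exprS.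
apply: (@le_trans _ _ (r 0%N * K / q * (q * q ^+ k))); last first.
  by rewrite lerDr mulr_ge0 ?exprn_ge0// ltW.
rewrite mulrA divfK ?gt_eqF// -mulrA ler_wpM2l//.
Qed.

(** * The majorant of the squared differences and its mean *)

Section envelope.
Context {R : realType} {d : nat}.
Variables (c : R) (b : nat -> R) (v0 : 'I_d -> R).

(* Majorant of the squared coordinates of [x^{i,k} - x^{j,k}] along the noise
   path [z]; unlike these, it is polynomial in [z], which makes measurability
   and independence immediate. *)
Fixpoint sqr_envelope (z : nat -> d.-tuple R) (k : nat) (l : 'I_d) : R :=
  if k is k'.+1 then
    2 * (sqr_envelope z k' l * (c - tnth (z k') l) ^+ 2) +
    b k' * \sum_(m < d) sqr_envelope z k' m
  else v0 l.

Context {dT : measure_display} {T : measurableType dT} (P : probability T R).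
Variables (eta : nat -> {RV P >-> d.-tuple R}) (rho : R).
Hypothesis eta_indep : mutually_independent P (fun k w => eta k w).
Hypothesis eta_dev : forall k l,
  (\int[P]_w ((c - tnth (eta k w) l) ^+ 2)%:E <= rho%:E)%E.
Hypothesis rho_ge0 : 0 <= rho.
Hypothesis b_ge0 : forall k, 0 <= b k.
Hypothesis v0_ge0 : forall l, 0 <= v0 l.

(** Independence and the mean bound share one induction, since the means at step [k.+1] factor
    thanks to independence at step [k]. Summed over coordinates, the common coupling term counts [d]
    times, hence [d%:R * b i]. *)
Lemma sqr_envelope_mean k : exists2 m : 'I_d -> R,
  forall l, indep_from eta k (fun w => sqr_envelope (eta ^~ w) k l) (m l)
  & \sum_(l < d) m l <= (\sum_(l < d) v0 l) *
      \prod_(i < k) (2 * rho + d%:R * b i).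
Proof.
elim: k => [|k [m mP m_le]].
  exists v0; last by rewrite big_ord0 mulr1.
  by move=> l; exact: indep_from_cst.
have m0 l : 0 <= m l by exact: indep_from_mean_ge0 (mP l).
(* The bound by [rho] makes the second moment a real number, as [indep_fromM] requires. *)
have /choice[p pP] l : exists p : R,
    (\int[P]_w ((c - tnth (eta k w) l) ^+ 2)%:E = p%:E)%E /\ p <= rho.
  have : (0 <= \int[P]_w ((c - tnth (eta k w) l) ^+ 2)%:E)%E.
    by apply: integral_ge0 => w _; rewrite lee_fin sqr_ge0.
  have := eta_dev k l.
  by case: (\int[P]_w _)%E => // p; rewrite lee_fin => prho _; exists p.
exists (fun l => 2 * (m l * p l) + b k * \sum_(l < d) m l) => [l /=|].
  apply: indep_fromD.
    apply: indep_fromZ => //.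
    have mpsi : measurable_fun [set: d.-tuple R]
        (fun z => (c - tnth z l) ^+ 2).
      apply: measurable_funX; apply: measurable_funB => //.
      exact: measurable_tnth.
    exact: (indep_fromM (mP l) mpsi (fun=> sqr_ge0 _) (pP l).1).
  by apply: indep_fromZ => //; apply: indep_fromS; exact: indep_from_sum.
rewrite big_ord_recr mulrA /=.
apply: (@le_trans _ _ ((\sum_(l < d) m l) * (2 * rho + d%:R * b k))).
  rewrite big_split /= sumr_const card_ord mulrDr lerD//.
    rewrite mulr_suml ler_sum// => l _.
    by rewrite mulrCA ler_wpM2l// ler_wpM2l//; case: (pP l).
  by rewrite -[leLHS]mulr_natl mulrA [leRHS]mulrC.
by rewrite ler_wpM2r// addr_ge0// mulr_ge0.
Qed.

End envelope.

(** * Deterministic estimates along one noise path *)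

Section pathwise.
Context {R : realType} {d : nat}.
Implicit Types x y : 'rV[R]_d.

Lemma sqr_enorm x : enorm x ^+ 2 = \sum_(l < d) x ord0 l ^+ 2.
Proof. by rewrite /enorm sqr_sqrtr// sumr_ge0// => l _; exact: sqr_ge0. Qed.

(** The values are paired as [f (x + e) - f (y + e)] and [f x - f y]: both pairs of points differ by
    [x - y], so each contributes [L * enorm (x - y)]. *)
Lemma fwd_grad_sqrB (L sigma : R) (f : 'rV[R]_d -> R) x y (l : 'I_d) :
  0 < sigma -> elipschitz L f ->
  (fwd_grad f sigma x ord0 l - fwd_grad f sigma y ord0 l) ^+ 2 <=
  4 * L ^+ 2 / sigma ^+ 2 * enorm (x - y) ^+ 2.
Proof.
move=> s0 fL; rewrite !mxE -mulrBl exprMn exprVn.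
rewrite [leRHS]mulrAC ler_wpM2r ?invr_ge0 ?sqr_ge0//.
set e := sigma *: _.
have := fL x y; have := fL (x + e) (y + e).
rewrite opprD addrACA subrr addr0; set n := L * _ => h1 h2.
have -> : 4 * L ^+ 2 * enorm (x - y) ^+ 2 = (2 * n) ^+ 2 by rewrite /n; ring.
rewrite -real_normK ?num_real// ler_pXn2r ?nnegrE//; last first.
  by rewrite mulr_ge0// (le_trans _ h1).
have -> : f (x + e) - f x - (f (y + e) - f y) =
  (f (x + e) - f (y + e)) - (f x - f y) by ring.
by rewrite (le_trans (ler_normB _ _))//; lra.
Qed.

Lemma escbo_stepB (N : nat) (f : 'rV[R]_d -> R) (beta lambda sigma a : R)
    (z : d.-tuple R) (x : 'I_N -> 'rV[R]_d) (i j : 'I_N) (l : 'I_d) :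
  (escbo_step f beta lambda sigma a z x i -
   escbo_step f beta lambda sigma a z x j) ord0 l =
  (1 - lambda - tnth z l) * (x i - x j) ord0 l -
  a * (fwd_grad f sigma (x i) ord0 l - fwd_grad f sigma (x j) ord0 l).
Proof.
rewrite /escbo_step /hadamard; set g := fwd_grad f sigma.
by rewrite !mxE; ring.
Qed.

(** The constant 8 is the 4 of [fwd_grad_sqrB] times the 2 of
    [(u - v) ^+ 2 <= 2 * u ^+ 2 + 2 * v ^+ 2]. The induction hypothesis is used at [l] for the noise
    term and summed over all coordinates for the gradient term. *)
Lemma sqr_coord_le_envelope (N : nat) (f : 'rV[R]_d -> R)
    (L beta lambda sigma : R) (alpha : nat -> R) (z : nat -> d.-tuple R)
    (x : 'I_N -> nat -> 'rV[R]_d) (i j : 'I_N) :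
  0 < sigma -> elipschitz L f ->
  (forall i k, x i k.+1 =
    escbo_step f beta lambda sigma (alpha k) (z k) (x ^~ k) i) ->
  forall k l, (x i k - x j k) ord0 l ^+ 2 <=
    sqr_envelope (1 - lambda) (fun k => 8 * L ^+ 2 / sigma ^+ 2 * alpha k ^+ 2)
      (fun l => (x i 0%N - x j 0%N) ord0 l ^+ 2) z k l.
Proof.
move=> s0 fL xS; elim=> [//|k IHk] l.
rewrite !xS escbo_stepB /=.
set u := _ * _; set v := _ * _.
have uv : (u - v) ^+ 2 <= 2 * u ^+ 2 + 2 * v ^+ 2.
  by have := sqr_ge0 (u + v); rewrite !expr2; lra.
apply: (le_trans uv); apply: lerD.
  by rewrite ler_wpM2l// /u exprMn mulrC ler_wpM2r// sqr_ge0.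
have gl := fwd_grad_sqrB (x i k) (x j k) l s0 fL.
have el : enorm (x i k - x j k) ^+ 2 <= \sum_(m < d) sqr_envelope (1 - lambda)
    (fun k => 8 * L ^+ 2 / sigma ^+ 2 * alpha k ^+ 2)
    (fun l => (x i 0%N - x j 0%N) ord0 l ^+ 2) z k m.
  by rewrite sqr_enorm ler_sum.
have L0 : 0 <= 4 * L ^+ 2 / sigma ^+ 2.
  by apply: divr_ge0; rewrite ?sqr_ge0//; apply: mulr_ge0; rewrite ?sqr_ge0.
have := ler_wpM2l (sqr_ge0 (alpha k)) (le_trans gl (ler_wpM2l L0 el)).
rewrite /v exprMn; set S := \sum_(m < d) _; set G := _ ^+ 2 * (_ - _) ^+ 2.
by move=> h; lra.
Qed.

End pathwise.

(** * From the pathwise majorant to exponential decay *)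

Lemma escbo_second_moment_le (R : realType) (disp : measure_display)
    (T : measurableType disp) (P : probability T R) (d N : nat)
    (f : 'rV[R]_d -> R) (L beta lambda delta sigma : R) (alpha : nat -> R)
    (x0 : 'I_N -> 'rV[R]_d) (eta : nat -> {RV P >-> d.-tuple R})
    (x : 'I_N -> nat -> T -> 'rV[R]_d) (i j : 'I_N) (k : nat) :
  elipschitz L f -> 0 <= delta -> 0 < sigma ->
  escbo_process f beta lambda delta sigma alpha x0 eta x ->
  (\int[P]_w (enorm (x i k w - x j k w) ^+ 2)%:E <=
   (enorm (x0 i - x0 j) ^+ 2 *
    \prod_(n < k) (2 * ((1 - lambda) ^+ 2 + delta ^+ 2) +
      d%:R * (8 * L ^+ 2 / sigma ^+ 2 * alpha n ^+ 2)))%:E)%E.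
Proof.
move=> fL delta0 sigma0 [[eta_law _ eta_ind] xI xS].
set b := fun n : nat => 8 * L ^+ 2 / sigma ^+ 2 * alpha n ^+ 2.
set v0 : 'I_d -> R := fun l => (x0 i - x0 j) ord0 l ^+ 2.
have eta_dev n l : (\int[P]_w ((1 - lambda - tnth (eta n w) l) ^+ 2)%:E <=
    ((1 - lambda) ^+ 2 + delta ^+ 2)%:E)%E.
  apply: gaussian_sqr_dev_le => //; last by move=> B mB; exact: eta_law.
  exact: (measurableT_comp (measurable_tnth l)).
have b0 n : 0 <= b n.
  apply: mulr_ge0; rewrite ?sqr_ge0//; apply: divr_ge0; rewrite ?sqr_ge0//.
  by apply: mulr_ge0; rewrite ?sqr_ge0.
have v00 l : 0 <= v0 l by exact: sqr_ge0.
have rho0 : 0 <= (1 - lambda) ^+ 2 + delta ^+ 2 by rewrite addr_ge0 ?sqr_ge0.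
have [m mP] := sqr_envelope_mean eta_ind eta_dev rho0 b0 v00 k.
rewrite -sqr_enorm => m_le.
(* The bound is rewritten as the integral of the summed majorant, which reduces the claim to a
   pointwise comparison. *)
have := indep_from_mean (indep_from_sum (index_enum 'I_d) eta_ind mP).
move: m_le; rewrite -lee_fin => /[swap] <-; apply: le_trans.
apply: ge0_le_integral_nonmeasurable => w; rewrite lee_fin ?sqr_ge0//.
rewrite sqr_enorm ler_sum// => l _.
have := sqr_coord_le_envelope (x := fun i k => x i k w) (z := eta ^~ w)
  i j sigma0 fL (fun i k => xS i k w) k l.
by rewrite !xI.
Qed.

Theorem theorem4p1 (R : realType) (disp : measure_display)
    (T : measurableType disp) (P : probability T R)
    (d N : nat) (N_gt0 : (0 < N)%N)
    (f : 'rV[R]_d -> R) (f_ge0 : forall x, 0 <= f x)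
    (Lf : R) (Lf_gt0 : 0 < Lf) (f_lip : elipschitz Lf f)
    (beta lambda delta sigma : R)
    (beta_gt0 : 0 < beta) (lambda_gt0 : 0 < lambda) (delta_ge0 : 0 <= delta)
    (sigma_gt0 : 0 < sigma)
    (alpha : nat -> R) (alpha_ge0 : forall k, 0 <= alpha k)
    (x0 : 'I_N -> 'rV[R]_d) (eta : nat -> {RV P >-> d.-tuple R})
    (x : 'I_N -> nat -> T -> 'rV[R]_d)
    (x_escbo : escbo_process f beta lambda delta sigma alpha x0 eta x)
    (lambda_delta : (1 - lambda) ^+ 2 + delta ^+ 2 < 2^-1)
    (alpha_cvg0 : alpha k @[k --> \oo] --> (0 : R)) :
  ((fun k => \big[maxe/-oo]_(ij : 'I_N * 'I_N)
      'E_P[fun w => (enorm (x ij.1 k w - x ij.2 k w) ^+ 2)%R])%E @ \oo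
    --> (0 : \bar R)%E) /\
  (exists C tau : R, [/\ 0 < C, 0 < tau &
     forall (k : nat) (i j : 'I_N),
       ('E_P[fun w => (enorm (x i k w - x j k w) ^+ 2)%R]
          <= (C * expR (- tau * k%:R))%:E)%E]).
Proof.
set rho := (1 - lambda) ^+ 2 + delta ^+ 2 in lambda_delta.
have rho0 : 0 <= rho by rewrite addr_ge0 ?sqr_ge0.
pose r k := 2 * rho + d%:R * (8 * Lf ^+ 2 / sigma ^+ 2 * alpha k ^+ 2).
have r0 k : 0 <= r k.
  apply: addr_ge0; first exact: mulr_ge0.
  apply: mulr_ge0 => //; apply: mulr_ge0; rewrite ?sqr_ge0//.
  by apply: divr_ge0; rewrite ?sqr_ge0//; apply: mulr_ge0; rewrite ?sqr_ge0.
have r_cvg : r k @[k --> \oo] --> 2 * rho.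
  have -> : 2 * rho =
      2 * rho + d%:R * (8 * Lf ^+ 2 / sigma ^+ 2 * (0 * 0)) by ring.
  apply: cvgD; first exact: cvg_cst.
  apply: cvgM; first exact: cvg_cst.
  apply: cvgM; first exact: cvg_cst.
  by under eq_fun do rewrite expr2; exact: cvgM.
(* The midpoint of [2 * rho] and 1: above the limit of [r], yet still below 1. *)
pose q := (1 + 2 * rho) / 2.
have q0 : 0 < q by rewrite /q; lra.
have q1 : q < 1 by rewrite /q; lra.
have rq : \forall k \near \oo, r k <= q.
  by apply: (cvgr_le _ r_cvg); rewrite /q; lra.
have [K K0 rK] := prod_le_geometric q0 r0 rq.
(* Summing over all pairs gives one constant for every [i] and [j]; the added 1 in [C] keeps it
   positive when all initial points coincide. *)
pose V := \sum_(ij : 'I_N * 'I_N) enorm (x0 ij.1 - x0 ij.2) ^+ 2.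
have V0 : 0 <= V by apply: sumr_ge0 => ij _; exact: sqr_ge0.
pose C := (1 + V) * K; pose tau := - ln q.
have C0 : 0 < C by rewrite mulr_gt0// ltr_pwDl.
have tau0 : 0 < tau by rewrite oppr_gt0 ln_lt0// q0.
have expq k : expR (- tau * k%:R) = q ^+ k.
  by rewrite /tau opprK expRM_natr lnK.
have bound k i j : ('E_P[fun w => (enorm (x i k w - x j k w) ^+ 2)%R]
    <= (C * expR (- tau * k%:R))%:E)%E.
  rewrite unlock expq.
  apply: (le_trans (escbo_second_moment_le i j k f_lip delta_ge0 sigma_gt0
    x_escbo)).
  rewrite lee_fin -[leRHS]mulrA; apply: ler_pM; last exact: rK.
  - exact: sqr_ge0.
  - by apply: prodr_ge0 => n _; exact: r0.
  - rewrite /V (bigD1 (i, j))//= addrCA lerDl addr_ge0// sumr_ge0// => ij _.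
    exact: sqr_ge0.
split; last by exists C, tau.
have geo0 : (C * expR (- tau * k%:R))%:E @[k --> \oo] --> (0 : \bar R)%E.
  apply/cvg_EFin; first exact: nearW.
  under eq_fun do rewrite /= expq.
  rewrite -(mulr0 C); apply: cvgM; first exact: cvg_cst.
  by apply: cvg_expr; rewrite ger0_norm// ltW.
apply: (squeeze_cvge _ (cvg_cst 0%E) geo0); apply: nearW => k.
apply/andP; split; last first.
  by apply: bigmax_le => [|ij _]; [exact: leNye|exact: bound].
(* An empty maximum would be [-oo]; since [N] is positive, the pair [(i0, i0)] bounds the maximum
   below by a nonnegative expectation. *)
pose i0 := Ordinal N_gt0.
apply: le_trans (le_bigmax _ _ (i0, i0)).
by rewrite unlock; apply: integral_ge0 => w _; rewrite lee_fin sqr_ge0.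
Qed.
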